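(* Let $GS_n^{(H)} = \sum_{k=L_n+1}^{L_{n+1}-1} \frac1k$ be the harmonic gap-sum of the Lucas sequence. Then $$GS_n^{(H)} = \ln(\alpha) + O(\alpha^{-n}), \qquad n\to\infty.$$ In particular, $\lim_{n\to\infty} GS_n^{(H)} = \ln(\alpha)$ (numerically $\approx 0.4812$).
   Context: $L_n$ ($n\ge1$) are the Lucas numbers: $L_1=1$, $L_2=3$, $L_n=L_{n-1}+L_{n-2}$ for $n\ge3$. $\alpha = \frac{1+\sqrt5}{2}$ is the golden ratio. Empty sums are $0$. *)

(* Defs.v *)
From HB Require Import structures.
From mathcomp Require Import all_boot all_order all_algebra.
From mathcomp Require Import all_classical all_reals all_analysis.

Set Implicit Arguments.
Unset Strict Implicit.
Unset Printing Implicit Defensive.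

Import Order.TTheory GRing.Theory Num.Theory.
Import numFieldNormedType.Exports.

Local Open Scope ring_scope.

(* The sequence is meant for n >= 1; lucas 0 = 2 is the value that extends
   the recurrence backwards from L_1 = 1, L_2 = 3. *)
Fixpoint lucas (n : nat) : nat :=
  match n with
  | 0 => 2
  | 1 => 1
  | (m.+1 as p).+1 => (lucas p + lucas m)%N
  end.

Fact lucas1 : lucas 1 = 1%N. Proof. by []. Qed.
Fact lucas2 : lucas 2 = 3%N. Proof. by []. Qed.
Fact lucasSS n : lucas n.+2 = (lucas n.+1 + lucas n)%N. Proof. by []. Qed.

Definition golden (R : realType) : R := (1 + Num.sqrt 5) / 2.

(* Big-operator ranges exclude the right endpoint: k runs from L_n + 1 to
   L_(n+1) - 1. *)
Definition harmonic_gap_sum (R : realType) (n : nat) : R :=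
  \sum_((lucas n).+1 <= k < lucas n.+1) k%:R^-1.

(* Main.v *)
Require Import Defs.
From HB Require Import structures.
From mathcomp Require Import all_boot all_order all_algebra.
From mathcomp Require Import all_classical all_reals all_analysis.
From mathcomp Require Import ring lra zify.

Import Order.TTheory GRing.Theory Num.Theory.
Import numFieldNormedType.Exports.

Local Open Scope classical_set_scope.
Local Open Scope ring_scope.

(** The numbers [1/k] for [k] strictly between [a] and [b] are squeezed between
    increments of the logarithm (the comparison of [1/x] with its integral), so
    their sum differs from [ln (b / a)] by at most [1/a].  For [a = L_n] and
    [b = L_(n+1)] the quotient [b / a] is close to the golden ratio [g]: the
    defect [L_(n+1) - g L_n] is a geometric sequence of ratio [-1/g]
    ([lucas_defectE]), hence of size [O(g^-n)], while [L_n] is at least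
    [g^n / 2] ([golden_exp_le_lucas]).  Both errors, [1 / L_n] and
    [ln (L_(n+1) / L_n) - ln g], are therefore [O(g^-n)], and
    [harmonic_gap_sum_error] gives the explicit constant 5 for every [n >= 1].
    The limit follows because [g > 1].

    The decimal value is obtained by applying the exponential:
    it suffices to place [g] between [exp (115/239)] and [exp (77/160)], which
    truncations of the exponential series with a bound on the tail
    ([expR_ge_partial], [expR_le_partial]) reduce to rational arithmetic. *)

(** * Sums of reciprocals and the logarithm *)

(** The logarithm lies below its tangent at [x].  As [x] and [y] may come in
    either order, this one inequality gives both an upper and a lower bound for
    the increment of [ln]. *)
Lemma ln_sub_le (R : realType) (x y : R) : 0 < x -> 0 < y ->
  ln y - ln x <= (y - x) / x.
Proof.
move=> x0 y0; rewrite -ln_div ?posrE//.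
have yx : 0 < y / x by rewrite divr_gt0.
have -> : y / x = 1 + (y - x) / x by field; rewrite gt_eqF.
apply: le_ln1Dx; rewrite mulrBl divff ?gt_eqF//; lra.
Qed.

Lemma sum_inv_le_ln (R : realType) (a b : nat) : (0 < a <= b)%N ->
  \sum_(a.+1 <= k < b.+1) (k%:R^-1 : R) <= ln b%:R - ln a%:R.
Proof.
move=> /andP[a0]; elim: b => [|b IH]; first by rewrite leqNgt a0.
rewrite leq_eqVlt => /predU1P[->|]; first by rewrite big_geq// subrr.
rewrite ltnS => ab; rewrite big_nat_recr//=.
have b0 : 0 < b%:R :> R by rewrite ltr0n (leq_trans a0).
have b1 : 0 < b.+1%:R :> R by rewrite ltr0n.
have := ln_sub_le _ _ _ b1 b0; have := IH ab.
rewrite -{3}[b.+1]addn1 natrD opprD addNKr mulN1r.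
by move: (_^-1) => v; lra.
Qed.

Lemma ln_le_sum_inv (R : realType) (a b : nat) : (a < b)%N ->
  ln b%:R - ln a.+1%:R <= \sum_(a.+1 <= k < b) (k%:R^-1 : R).
Proof.
elim: b => [//|b IH]; rewrite ltnS leq_eqVlt => /predU1P[->|ab].
  by rewrite big_geq// subrr.
rewrite big_nat_recr//=.
have b0 : 0 < b%:R :> R by rewrite ltr0n (leq_ltn_trans _ ab).
have b1 : 0 < b.+1%:R :> R by rewrite ltr0n.
have := ln_sub_le _ _ _ b0 b1; have := IH ab.
rewrite -{2}[b.+1]addn1 natrD [_ + 1]addrC addrK mul1r.
by move: (b%:R^-1) => v; lra.
Qed.

(** * The golden ratio and the Lucas numbers *)

(** A rational number is compared with the golden ratio by squaring, which
    turns a bound on [Num.sqrt 5] into one that [lra] decides. *)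
Lemma golden_between (R : realType) (p q : R) : 1 <= p ->
  (2 * p - 1) ^+ 2 < 5 -> 1 <= q -> 5 < (2 * q - 1) ^+ 2 ->
  p < golden R < q.
Proof.
move=> p1 hp q1 hq; rewrite /golden.
have s0 := sqrtr_ge0 (5 : R).
have s2 : Num.sqrt 5 ^+ 2 = 5 :> R by rewrite sqr_sqrtr.
have : 2 * p - 1 < Num.sqrt 5 by rewrite -(ltr_pXn2r (ltn0Sn 1)) ?nnegrE ?s2//; lra.
have : Num.sqrt 5 < 2 * q - 1 by rewrite -(ltr_pXn2r (ltn0Sn 1)) ?nnegrE ?s2//; lra.
lra.
Qed.

Lemma golden_sqr (R : realType) : golden R ^+ 2 = golden R + 1.
Proof.
have s2 : Num.sqrt 5 ^+ 2 = 5 :> R by rewrite sqr_sqrtr.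
by rewrite /golden; field: s2.
Qed.

Lemma golden_bounds (R : realType) : 1 < golden R < 2.
Proof. by apply: golden_between; lra. Qed.

Lemma lucas_gt0 n : (0 < lucas n)%N.
Proof.
suff : (0 < lucas n)%N && (0 < lucas n.+1)%N by case/andP.
elim: n => [//|n /andP[h1 h2]]; rewrite h2 lucasSS/=; lia.
Qed.

Lemma lucas_ltS n : (0 < n)%N -> (lucas n < lucas n.+1)%N.
Proof. by case: n => [//|n _]; rewrite lucasSS; have := lucas_gt0 n; lia. Qed.

(** Both sides satisfy the Fibonacci recurrence, so the inequality propagates
    from [n = 0] and [n = 1]; the factor 2 is there because
    [L_1 = 1 < golden R < 2]. *)
Lemma golden_exp_le_lucas (R : realType) n :
  golden R ^+ n <= 2 * (lucas n)%:R.
Proof.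
suff : golden R ^+ n <= 2 * (lucas n)%:R /\
       golden R ^+ n.+1 <= 2 * (lucas n.+1)%:R by case.
elim: n => [|n [h1 h2]]; first by have := golden_bounds R; rewrite /=; lra.
split=> //; rewrite lucasSS natrD.
have -> : golden R ^+ n.+2 = golden R ^+ n.+1 + golden R ^+ n.
  by rewrite -addn2 exprD golden_sqr exprS; ring.
by lra.
Qed.

(** The other root of [x ^+ 2 = x + 1] is [- (golden R)^-1], so the
    defect [L_(n+1) - golden R * L_n] is a geometric sequence of that ratio. *)
Lemma lucas_defectE (R : realType) n :
  (lucas n.+1)%:R - golden R * (lucas n)%:R =
  (1 - 2 * golden R) * (- (golden R)^-1) ^+ n.
Proof.
have /andP[g1 _] := golden_bounds R.
have gV : - (golden R)^-1 = 1 - golden R.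
  have g0 : golden R != 0 by rewrite gt_eqF//; lra.
  by apply: (mulfI g0); rewrite mulrN divff// mulrBr -expr2 golden_sqr; ring.
elim: n => [|n IH]; first by rewrite /= expr0; ring.
rewrite exprS mulrCA -IH gV lucasSS natrD mulrBl mul1r mulrBr mulrA -expr2.
by rewrite golden_sqr; ring.
Qed.

Lemma lucas_defect_le (R : realType) n :
  `|(lucas n.+1)%:R - golden R * (lucas n)%:R| <= 3 * golden R ^- n.
Proof.
have /andP[g1 g2] := golden_bounds R.
have g0 : 0 < golden R by lra.
rewrite lucas_defectE normrM normrX normrN normfV (gtr0_norm g0) exprVn.
rewrite ler_wpM2r ?invr_ge0 ?exprn_ge0 ?(ltW g0)//.
by rewrite ler_norml; lra.
Qed.

(** With [g] the golden ratio, of the constant 5, a part 3 bounds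
    [ln (L_(n+1) / L_n) - ln g] through the defect, and a part 2 bounds
    [ln ((L_n + 1) / L_n)], the width of the interval in which the logarithmic
    estimates place the sum. *)
Lemma harmonic_gap_sum_error (R : realType) n : (0 < n)%N ->
  `|harmonic_gap_sum R n - ln (golden R)| <= 5 * golden R ^- n.
Proof.
move=> n0; have /andP[g1 g2] := golden_bounds R; rewrite /harmonic_gap_sum.
have an := lucas_gt0 n; have ab := lucas_ltS _ n0.
have := golden_exp_le_lucas R n; have := lucas_defect_le R n.
have := @ln_le_sum_inv R _ _ ab.
have : \sum_((lucas n).+1 <= k < lucas n.+1) (k%:R^-1 : R) <=
    ln (lucas n.+1)%:R - ln (lucas n)%:R.
  case: (lucas n.+1) ab => [//|b]; rewrite ltnS => ab.
  have b0 : (0 < b)%N := leq_trans an ab.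
  apply: le_trans (@sum_inv_le_ln R _ b _) _; first by rewrite an.
  by rewrite lerB// ler_ln ?posrE ?ltr0n// ler_nat.
move: (\sum_(_ <= _ < _) _) => S.
have a1 : 1 <= (lucas n)%:R :> R by rewrite ler1n.
have b1 : 1 <= (lucas n.+1)%:R :> R by rewrite ler1n lucas_gt0.
rewrite -[(lucas n).+1]addn1 natrD.
move: (lucas n)%:R (lucas n.+1)%:R a1 b1 => a b a1 b1 hu hl.
have gn : 0 < golden R ^+ n by rewrite exprn_gt0//; lra.
rewrite ler_norml => /andP[d1 d2] ga.
have e0 : 0 < golden R ^- n by rewrite invr_gt0.
have a0 : 0 < a by lra. have b0 : 0 < b by lra.
have g0 : 0 < golden R by lra. have a10 : 0 < a + 1 by lra.
have ga0 : 0 < golden R * a by rewrite mulr_gt0.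
have ga1 : 1 <= golden R * a by nra.
have aV : a^-1 <= 2 * golden R ^- n.
  by rewrite -[2]invrK -invfM lef_pV2 ?posrE ?mulr_gt0//; lra.
have t1 := ln_sub_le _ _ _ a0 a10.
(* Both signs of the defect occur, so the tangent bound is used both ways. *)
have t2 := ln_sub_le _ _ _ ga0 b0; have t3 := ln_sub_le _ _ _ b0 ga0.
have u2 : (b - golden R * a) / (golden R * a) <= 3 * golden R ^- n.
  by rewrite ler_pdivrMr//; nra.
have u3 : (golden R * a - b) / b <= 3 * golden R ^- n.
  by rewrite ler_pdivrMr//; nra.
rewrite lnM ?posrE// in t2 t3.
rewrite [a + 1]addrC addrK mul1r in t1 hl.
rewrite ler_norml; apply/andP; split; lra.
Qed.

(** * The numerical value of the limit *)

Lemma expR_ge_partial (R : realType) (y : R) n : 0 <= y ->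
  series (exp_coeff y) n <= expR y.
Proof.
move=> y0; apply: nondecreasing_cvgn_le; last exact: is_cvg_series_exp_coeff.
by apply/nondecreasing_series => k _ _; exact: exp_coeff_ge0.
Qed.

(** Once [2 * y <= n.+1], each term of the exponential series is at most half
    the one before it, so the tail is dominated by twice its first term. *)
Lemma expR_le_partial (R : realType) (y : R) n : 0 <= y -> 2 * y <= n.+1%:R ->
  expR y <= series (exp_coeff y) n + 2 * exp_coeff y n.
Proof.
move=> y0 yn.
have step m : (n <= m)%N -> series (exp_coeff y) m + 2 * exp_coeff y m <=
    series (exp_coeff y) n + 2 * exp_coeff y n.
  elim: m => [|m IH]; first by rewrite leqn0 => /eqP ->.
  rewrite leq_eqVlt => /predU1P[->//|]; rewrite ltnS => nm.
  apply: le_trans (IH nm); rewrite seriesSr.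
  have c0 := exp_coeff_ge0 m y0.
  have -> : exp_coeff y m.+1 = exp_coeff y m * (y / m.+1%:R).
    rewrite /exp_coeff /= exprS factS natrM; field.
    by rewrite nat1r !pnatr_eq0 -!lt0n fact_gt0.
  have h : y / m.+1%:R <= 1 / 2.
    rewrite ler_pdivrMr ?ltr0n//.
    have : n.+1%:R <= m.+1%:R :> R by rewrite ler_nat.
    lra.
  have := ler_wpM2l c0 h; move: (exp_coeff y m) (series _ m) (y / _) => c s r.
  by lra.
apply: limr_le; first exact: is_cvg_series_exp_coeff.
exists n => // m /= nm; apply: le_trans (step _ nm).
by rewrite lerDl mulr_ge0// exp_coeff_ge0.
Qed.

(** The bounds on the golden ratio are quotients of consecutive Fibonacci
    numbers, [377/233] and [233/144].  The exponent [77/160] is the right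
    end of the allowed interval for [ln (golden R)], and [115/239] a fraction
    of small denominator inside it; six terms of the exponential series are precise enough to
    compare them. *)
Lemma ln_golden_approx (R : realType) :
  `|ln (golden R) - 4812 / 10 ^+ 4| < 5 / 10 ^+ 5 :> R.
Proof.
have /andP[g1 g2] : 377 / 233 < golden R < 233 / 144.
  by apply: golden_between; lra.
have g0 : 0 < golden R by lra.
have lo : expR (115 / 239) < golden R.
  apply: le_lt_trans (@expR_le_partial R _ 6 _ _) _; [lra|lra|].
  rewrite /series/= !big_nat_recr//= big_geq// /exp_coeff/= !factS fact0.
  by lra.
have hi : golden R < expR (77 / 160).
  apply: lt_le_trans (@expR_ge_partial R _ 6 _); last lra.
  rewrite /series/= !big_nat_recr//= big_geq// /exp_coeff/= !factS fact0.
  by lra.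
rewrite -{1}(@lnK _ (golden R)) ?posrE// ltr_expR in lo.
rewrite -{1}(@lnK _ (golden R)) ?posrE// ltr_expR in hi.
by rewrite ltr_norml; lra.
Qed.

Theorem lemma4p9 (R : realType) :
  [/\ (harmonic_gap_sum R : nat -> R^o) =
        cst (ln (golden R)) +O_\oo ((fun n => golden R ^- n) : nat -> R^o),
      harmonic_gap_sum R n @[n --> \oo] --> ln (golden R)
    & `|ln (golden R) - 4812 / 10 ^+ 4| < 5 / 10 ^+ 5 :> R].
Proof.
have /andP[g1 g2] := golden_bounds R.
have g0 : 0 < golden R by lra.
split; last exact: ln_golden_approx.
- apply/eqaddOP/bigO_exP; exists 5 => //; exists 1%N => // n /= n1.
  have /= := @harmonic_gap_sum_error R n n1.
  by rewrite [X in _ -> _ <= 5 * X]gtr0_norm ?invr_gt0 ?exprn_gt0.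
- apply/subr_cvg0/norm_cvg0P.
  apply: (@squeeze_cvgr _ _ _ _ (cst 0) (fun n => 5 * golden R ^- n)).
  + exists 1%N => // n /= n1; rewrite normr_ge0/=.
    exact: harmonic_gap_sum_error.
  + exact: cvg_cst.
  + rewrite -[0 in X in _ --> X](mulr0 5); apply: cvgMr.
    under eq_fun do rewrite -exprVn.
    by apply: cvg_expr; rewrite gtr0_norm ?invr_gt0// invf_lt1.
Qed.
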